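(* Let $(G_1,G_2)$ be a matched pair of locally compact groups, realized as closed subgroups of a locally compact group $H$, and suppose that $G_2$ is compact. Then $G_1G_2=H$, and for all $(\gamma,g)\in G_1\times G_2$ there exists a unique pair $(\alpha_\gamma(g),\beta_g(\gamma))\in G_2\times G_1$ such that $\gamma g=\alpha_\gamma(g)\beta_g(\gamma)$. Moreover: \begin{enumerate} \item For $g,h\in G_2$ and $r,s\in G_1$ we have $$\alpha_r(gh)=\alpha_r(g)\,\alpha_{\beta_g(r)}(h),\quad \beta_g(rs)=\beta_{\alpha_s(g)}(r)\,\beta_g(s),\quad \alpha_r(e)=e,\quad \beta_g(e)=e.$$ \item $\alpha$ is a continuous left action of $G_1$ on the topological space $G_2$. Moreover, the Haar measure on $G_2$ is $\alpha$-invariant whenever $G_1$ is discrete. \item $\beta$ is a continuous right action of $G_2$ on the topological space $G_1$. \item $\alpha$ is trivial if and only if $G_1$ is normal in $H$. Also, $\beta$ is trivial if and only if $G_2$ is normal in $H$. \end{enumerate}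
   Context: All locally compact groups are Hausdorff; as standing assumptions, discrete groups are countable and compact groups are Hausdorff and second countable. A pair of locally compact groups $(G_1,G_2)$ is called matched if both $G_1,G_2$ are closed subgroups of a locally compact group $H$ satisfying $G_1\cap G_2=\{e\}$ and such that the complement of $G_1G_2$ in $H$ has Haar measure zero. *)

(* Defs.v *)
From HB Require Import structures.
From mathcomp Require Import all_boot all_order all_algebra.
From mathcomp Require Import all_classical all_reals all_analysis.

Set Implicit Arguments.
Unset Strict Implicit.
Unset Printing Implicit Defensive.

Local Open Scope classical_set_scope.
Local Open Scope ring_scope.
Local Open Scope group_scope.

(* Pointedness is only needed because the library builds generated
   sigma-algebras on pointed types. *)
HB.mixin Record isTopologicalGroup G & PointedTopological G & Group G := {
  mulg_continuous : continuous (fun x : G * G => x.1 * x.2) ;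
  invg_continuous : continuous (fun x : G => x^-1)
}.

#[short(type="topologicalGroupType")]
HB.structure Definition TopologicalGroup :=
  {G of PointedTopological G & Group G & isTopologicalGroup G}.

Record subgroup (G : groupType) := Subgroup {
  subgroup_set :> set G ;
  subgroup_closed : group_closed (fun x => x \in subgroup_set)
}.

HB.instance Definition _ (T : choiceType) (A : set T) :=
  SubChoice.copy (set_type A) {x | x \in A}.

HB.instance Definition _ (G : groupType) (S : subgroup G) :=
  SubChoice_isSubGroup.Build G (fun x => x \in subgroup_set S)
    (set_type (subgroup_set S)) (subgroup_closed S).

(* A subgroup of a topological group, seen as a type, is a topological group for
   the subspace topology, which the library already puts on [set_type]. *)
Section subgroup_topologicalGroup.
Variables (G : topologicalGroupType) (S : subgroup G).

HB.instance Definition _ := isPointed.Build (set_type (subgroup_set S)) 1.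

Let val_continuous : continuous (\val : S -> G).
Proof. exact: initial_continuous. Qed.

Let subgroup_mulg_continuous : continuous (fun x : S * S => x.1 * x.2).
Proof.
apply: continuous_comp_initial => x.
rewrite (_ : _ \o _ = fun x : S * S => \val x.1 * \val x.2); last first.
  by apply/funext => y; rewrite /= /set_val /=.
apply: (@continuous2_cvg _ _ _ _ _ _ (fun x : S * S => \val x.1)
  (fun x : S * S => \val x.2) (fun a b : G => a * b)).
- exact: (mulg_continuous (\val x.1, \val x.2)).
- by apply: continuous_comp; [exact: cvg_fst|exact: val_continuous].
- by apply: continuous_comp; [exact: cvg_snd|exact: val_continuous].
Qed.

Let subgroup_invg_continuous : continuous (fun x : S => x^-1).
Proof.
apply: continuous_comp_initial => x.
rewrite (_ : _ \o _ = (fun x : G => x^-1) \o \val); last first.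
  by apply/funext => y /=.
by apply: continuous_comp; [exact: val_continuous|exact: invg_continuous].
Qed.

HB.instance Definition _ :=
  isTopologicalGroup.Build (set_type (subgroup_set S))
    subgroup_mulg_continuous subgroup_invg_continuous.

End subgroup_topologicalGroup.

Definition normal_subgroup (G : groupType) (S : subgroup G) :=
  forall x y : G, subgroup_set S x -> subgroup_set S (x ^ y).

Definition locally_compact_group (G : topologicalGroupType) :=
  hausdorff_space G /\ locally_compact [set: G].

(* By convention, compact groups are second countable and discrete groups are
   countable. *)
Definition compact_group (G : topologicalGroupType) :=
  [/\ hausdorff_space G, compact [set: G] & @second_countable G].

Definition discrete_group (G : topologicalGroupType) :=
  (forall A : set G, open A) /\ countable [set: G].

Definition borel (T : ptopologicalType) := g_sigma_algebraType (@open T).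

Section haar.
Variables (R : realType).

Definition radon_measure (T : ptopologicalType)
    (mu : {measure set (borel T) -> \bar R}) :=
  [/\ forall K : set T, compact K -> (mu K < +oo)%E,
      forall A : set (borel T), measurable A ->
        mu A = ereal_inf [set mu U | U in [set U : set T | open U /\ A `<=` U]]
    & forall U : set T, open U ->
        mu U = ereal_sup [set mu K | K in [set K : set T | compact K /\ K `<=` U]]].

Definition haar_measure (G : topologicalGroupType)
    (mu : {measure set (borel G) -> \bar R}) :=
  [/\ radon_measure mu, mu [set: G] <> 0%E
    & forall (g : G) (A : set (borel G)), measurable A ->
        mu [set g * x | x in (A : set G)] = mu A].

(* Haar measures are unique up to a positive scalar, so the last clause does not
   depend on the choice of [mu]. The complement is not assumed to be Borel. *)
Definition matched_pair (H : topologicalGroupType) (G1 G2 : subgroup H) :=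
  [/\ locally_compact_group H,
      closed (G1 : set H) /\ closed (G2 : set H),
      (G1 : set H) `&` G2 = [set 1]
    & exists mu : {measure set (borel H) -> \bar R},
        haar_measure mu /\
        mu.-negligible (~` [set x * y | x in (G1 : set H) & y in (G2 : set H)])].

Definition invariant_measure (G : Type) (T : ptopologicalType)
    (a : G -> T -> T) (mu : {measure set (borel T) -> \bar R}) :=
  forall (g : G) (A : set (borel T)), measurable A -> mu (a g @^-1` A) = mu A.

End haar.

Definition continuous_left_action (G : topologicalGroupType)
    (T : topologicalType) (a : G -> T -> T) :=
  [/\ forall x, a 1 x = x,
      forall g h x, a (g * h) x = a g (a h x)
    & continuous (fun p : G * T => a p.1 p.2)].

Definition continuous_right_action (G : topologicalGroupType)
    (T : topologicalType) (b : G -> T -> T) :=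
  [/\ forall x, b 1 x = x,
      forall g h x, b (g * h) x = b h (b g x)
    & continuous (fun p : T * G => b p.2 p.1)].

Definition trivial_action (G T : Type) (a : G -> T -> T) :=
  forall g x, a g x = x.

(* Main.v *)
Require Import Defs.
From HB Require Import structures.
From mathcomp Require Import all_boot all_order all_algebra.
From mathcomp Require Import all_classical all_reals all_analysis.

(** Since [G1] is closed and [G2] is compact, the product [G1 G2] is closed in
    [H] ([closed_mul_compact]). Its complement is therefore open and null, and
    a Haar measure charges every nonempty open set ([haar_measure_open_neq0]),
    so [G1 G2 = H]. Taking inverses, every element of [H] is a product [a b]
    with [a] in [G2] and [b] in [G1], and [G1] and [G2] meeting trivially makes
    the factors unique. The cocycle identities, the action laws and the two
    normality criteria are then obtained by factoring one element of [H] in two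
    ways.

    For continuity, [alpha r g = a] holds exactly when [a^-1 r g] lies in the
    closed set [G1], so [alpha] has a closed graph; as it takes values in a
    compact space it is continuous ([closed_graph_continuous]), and
    [beta g r = (alpha r g)^-1 r g] follows.

    The invariance of the Haar measure [nu] of [G2] rests on two facts. First,
    by Fubini a finite left invariant measure and a finite right invariant
    measure with the same mass coincide ([invariant_left_right]); applied to
    the image of [nu] under inversion this shows that [nu] is also right
    invariant. Secondly, when [G1] is discrete, conjugating a right translation
    by [alpha r] gives
      [alpha r^-1 (alpha r x * z) = x * alpha (beta x r)^-1 z],
    a bijection of [G2] which is a right translation on each of the countably
    many open sets [{x | beta x r = u}], and which thus preserves [nu]
    ([piecewise_right_translation_preserves]). This says precisely that the
    image of [nu] under [alpha r] is right invariant, so that it equals [nu]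
    by the first fact. *)

Set Implicit Arguments.
Unset Strict Implicit.
Unset Printing Implicit Defensive.

Import Order.TTheory.

Local Open Scope classical_set_scope.
Local Open Scope ring_scope.
Local Open Scope group_scope.

(** * Compactness and continuity in topological groups *)

Lemma continuous_mulg (T : topologicalType) (G : topologicalGroupType)
    (f g : T -> G) :
  continuous f -> continuous g -> continuous (fun x => f x * g x).
Proof.
move=> cf cg x; apply: (@continuous2_cvg _ _ _ _ _ _ f g (fun a b : G => a * b)).
- exact: (mulg_continuous (f x, g x)).
- exact: cf.
- exact: cg.
Qed.

Lemma continuous_invg (T : topologicalType) (G : topologicalGroupType)
    (f : T -> G) : continuous f -> continuous (fun x => (f x)^-1).
Proof.
by move=> cf x; apply: continuous_comp; [exact: cf|exact: invg_continuous].
Qed.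

Lemma continuous_mulgl (G : topologicalGroupType) (a : G) :
  continuous (fun x : G => a * x).
Proof. by apply: continuous_mulg => x; [exact: cvg_cst|exact: cvg_id]. Qed.

Lemma continuous_mulgr (G : topologicalGroupType) (a : G) :
  continuous (fun x : G => x * a).
Proof. by apply: continuous_mulg => x; [exact: cvg_id|exact: cvg_cst]. Qed.

Lemma image_mulgl (G : groupType) (a : G) (A : set G) :
  [set a * x | x in A] = (fun x => a^-1 * x) @^-1` A.
Proof.
apply/seteqP; split=> [_ [x Ax <-]|x Ax] /=; first by rewrite mulKg.
by exists (a^-1 * x); rewrite // mulVKg.
Qed.

Lemma open_preimage_mulgl (G : topologicalGroupType) (a : G) (A : set G) :
  open A -> open ((fun x => a * x) @^-1` A).
Proof. by move=> oA; apply: open_comp => // x _; exact: continuous_mulgl. Qed.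

(** If [p] is not in [A K] then no [p k^-1] is in [A]; by compactness of [K] this
    persists, uniformly in [k], for all points near [p]. *)
Lemma closed_mul_compact (G : topologicalGroupType) (A K : set G) :
  closed A -> compact K -> closed [set a * k | a in A & k in K].
Proof.
move=> cA cK; rewrite closedE => p; apply: contra_notP => nAKp.
have /compact_near_coveringP cov := cK.
have cdiv : continuous (fun q : G * G => q.2 * q.1^-1).
  apply: continuous_mulg; first by move=> ?; exact: cvg_snd.
  by apply: continuous_invg => ?; exact: cvg_fst.
have : \forall q \near nbhs p, K `<=` (fun k => ~ A (q * k^-1)).
  apply: cov => k Kk.
  have oA : open ((fun q : G * G => q.2 * q.1^-1) @^-1` ~` A).
    by apply: open_comp => [? _|]; [exact: cdiv|rewrite openC].
  have : nbhs (k, p) ((fun q : G * G => q.2 * q.1^-1) @^-1` ~` A).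
    apply: open_nbhs_nbhs; split=> //= Apk.
    by apply: nAKp; exists (p * k^-1) => //; exists k; rewrite // mulgVK.
  by [].
apply: filterS => q KnA [a Aa [k Kk akq]].
by apply: (KnA k Kk); rewrite -akq mulgK.
Qed.

(** For an open [U] containing [f x], the graph avoids a neighbourhood of
    [(x, y)] for each [y] outside [U]; compactness of the complement of [U] makes
    the neighbourhood of [x] independent of [y]. *)
Lemma closed_graph_continuous (X Y : topologicalType) (f : X -> Y) :
  compact [set: Y] -> closed [set p : X * Y | f p.1 = p.2] -> continuous f.
Proof.
move=> cY; rewrite -openC => oG; apply/continuousP => U oU.
rewrite openE => x Ufx.
have cU : compact (~` U) by apply: subclosed_compact cY _ => //; rewrite closedC.
move/compact_near_coveringP: cU => cov.
have : \forall z \near nbhs x, ~` U `<=` (fun y => f z <> y).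
  apply: cov => y nUy.
  have : nbhs (x, y) [set p : X * Y | f p.1 <> p.2].
    by apply: open_nbhs_nbhs; split=> //= fxy; apply: nUy; rewrite -fxy.
  move=> [[P Q] [Px Qy] PQ]; exists (Q, P) => // -[y' x'] [Qy' Px'].
  exact: (PQ (x', y')).
apply: filterS => z KnA.
by apply: contrapT => nUfz; exact: KnA nUfz _.
Qed.

(** * Borel sets and Haar measures *)

Lemma borel_measurable_open (T : ptopologicalType) (U : set T) :
  open U -> measurable (U : set (borel T)).
Proof. exact: sub_sigma_algebra. Qed.

Lemma borel_measurable_closed (T : ptopologicalType) (F : set T) :
  closed F -> measurable (F : set (borel T)).
Proof.
rewrite -openC => oF; rewrite -[F]setCK; apply: measurableC.
exact: borel_measurable_open.
Qed.

Lemma continuous_borel_measurable (T T' : ptopologicalType) (f : T -> T') :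
  continuous f -> measurable_fun [set: borel T] (f : borel T -> borel T').
Proof.
move=> cf; apply: (@measurability _ _ (borel T) (borel T') _ f (@open T')).
  by [].
move=> _ [U oU <-].
by rewrite setTI; apply: borel_measurable_open; apply: open_comp.
Qed.

Lemma borel_measurable_preimage (T T' : ptopologicalType) (f : T -> T')
    (A : set (borel T')) :
  continuous f -> measurable A -> measurable (f @^-1` A : set (borel T)).
Proof.
by move=> cf mA; rewrite -[X in measurable X]setTI;
  exact: continuous_borel_measurable.
Qed.

Lemma haar_measure_invariant (R : realType) (G : topologicalGroupType)
    (mu : {measure set (borel G) -> \bar R}) :
  haar_measure mu -> invariant_measure (fun g x : G => g * x) mu.
Proof.
move=> [_ _ inv] g A mA.
by rewrite -(inv g^-1 A mA) image_mulgl invgK.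
Qed.

(** If [U] were null, then so would be every compact set, being covered by
    finitely many translates of [U]; inner regularity would give a null group. *)
Lemma haar_measure_open_neq0 (R : realType) (G : topologicalGroupType)
    (mu : {measure set (borel G) -> \bar R}) (U : set G) (x : G) :
  hausdorff_space G -> haar_measure mu -> open U -> U x -> mu U <> 0%E.
Proof.
move=> hG hmu oU Ux U0.
have [[_ _ inner] muT _] := hmu.
apply: muT; apply/eqP; rewrite eq_le measure_ge0 andbT.
rewrite inner; last exact: openT.
apply: ge_ereal_sup => _ [K [cK _] <-].
pose V (g : G) := (fun y => g * y) @^-1` U.
have oV g : open (V g) by exact: open_preimage_mulgl.
have mV g : measurable (V g : set (borel G)) by exact: borel_measurable_open.
have [D _ KD] : finite_subset_cover [set: G] V K.
  move: cK; rewrite compact_cover; apply => // y _.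
  (* the translate of U by y x^-1 contains y *)
  by exists (x * y^-1) => //; rewrite /V /= mulgVK.
have mW (s : seq G) : measurable (\big[setU/set0]_(g <- s) V g : set (borel G)).
  exact: bigsetU_measurable.
have W0 (s : seq G) : mu (\big[setU/set0]_(g <- s) V g) = 0%E.
  elim: s => [|g s IHs]; first by rewrite big_nil measure0.
  rewrite big_cons; apply: null_set_setU => //.
  by rewrite -U0; apply: haar_measure_invariant => //; exact: borel_measurable_open.
rewrite coverE bigcup_fset in KD.
rewrite -(W0 (finmap.enum_fset D)); apply: le_measure; rewrite ?inE //.
by apply: borel_measurable_closed; exact: compact_closed.
Qed.

(** * Left and right invariant measures *)

(** The Borel sigma-algebra of a product may be larger than the product of the
    Borel sigma-algebras. A countable base of one factor excludes this: [W] is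
    the union, over basic open sets [b], of [b] times the largest open set
    [V b] such that [b `*` V b] lies in [W]. *)
Lemma open_prod_measurable (T T' : ptopologicalType) (W : set (T * T')) :
  @second_countable T -> open W ->
  measurable (W : set (borel T * borel T')%type).
Proof.
move=> [B cB [oB bB]] oW.
pose V (b : set T) : set T' :=
  \bigcup_(Q in [set Q | open Q /\ b `*` Q `<=` W]) Q.
rewrite (_ : W = \bigcup_(b in B) (b `*` V b)); last first.
  apply/seteqP; split=> [[x y] Wxy|[x y] [b Bb [/= bx [Q [_ QW] Qy]]]]; last first.
    exact: QW.
  have [[P Q] /= [Px Qy] PQW] : nbhs (x, y) W by exact: open_nbhs_nbhs.
  have [b [Bb bx] bP] := bB x P Px.
  exists b => //; split=> //=.
  move: Qy; rewrite nbhsE => -[Q' [oQ' Q'y] Q'Q].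
  exists Q' => //; split=> // -[x' y'] [/= bx' Q'y'].
  by apply: PQW; split; [exact: bP|exact: Q'Q].
rewrite bigcup_set_type; apply: countable_bigcupT_measurable => [|b].
  by rewrite (eq_countable (card_setT B)).
apply: measurableX.
  by apply: borel_measurable_open; apply: oB; exact: set_valP.
by apply: borel_measurable_open; apply: bigcup_open => Q [].
Qed.

Lemma bundle_finite_measure d (T : measurableType d) (R : realType)
    (mu : {measure set T -> \bar R}) :
  (mu setT < +oo)%E ->
  exists m : {finite_measure set T -> \bar R}, forall A, m A = mu A.
Proof.
move=> /lty_fin_num_fun fin_mu.
have sigma_mu : sigma_finite setT mu.
  by apply: fin_num_fun_sigma_finite => //; rewrite measure0.
pose H1 := isFinite.Build _ _ _ mu fin_mu.
pose H2 := isSFinite.Build _ _ _ mu (sfinite_measure_sigma_finite sigma_mu).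
pose H3 := isSigmaFinite.Build _ _ _ mu sigma_mu.
by exists (HB.pack_for (FiniteMeasure.type T R) (Measure.sort mu) H1 H2 H3).
Qed.

(** Integrate the indicator of [{(x, y) | x y \in A}] in both orders: the section
    at [x] is a left translate of [A], of constant [nu]-measure, and the section
    at [y] is a right translate of [A], of constant [mu]-measure. *)
Lemma invariant_left_right (R : realType) (G : topologicalGroupType)
    (mu nu : {measure set (borel G) -> \bar R}) :
  @second_countable G -> (mu setT < +oo)%E -> (nu setT < +oo)%E ->
  invariant_measure (fun g x : G => x * g) mu ->
  invariant_measure (fun g x : G => g * x) nu ->
  forall A : set (borel G), measurable A -> (mu A * nu setT = nu A * mu setT)%E.
Proof.
move=> scG mufin nufin muR nuL A mA.
have [m1 m1E] := bundle_finite_measure mufin.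
have [m2 m2E] := bundle_finite_measure nufin.
pose S : set (borel G * borel G)%type := (fun p : G * G => p.1 * p.2) @^-1` A.
have mS : measurable S.
  have : measurable_fun setT
      ((fun p : G * G => p.1 * p.2) : (borel G * borel G)%type -> borel G).
    apply: (@measurability _ _ (borel G * borel G)%type (borel G) _ _ (@open G)).
      by [].
    move=> _ [U oU <-]; rewrite setTI; apply: open_prod_measurable => //.
    by apply: open_comp => // ? _; exact: mulg_continuous.
  by move=> /(_ measurableT _ mA); rewrite setTI.
have := indic_fubini_tonelli m1 m2 mS.
rewrite indic_fubini_tonelli_FE// indic_fubini_tonelli_GE//.
have -> : m2 \o xsection S = cst (fine (nu A))%:E.
  apply/funext => x; apply: etrans (m2E _) _.
  rewrite (_ : xsection S x = (fun y => x * y) @^-1` A); last first.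
    by apply/seteqP; split=> y; rewrite /xsection /S /= inE.
  by rewrite nuL // fineK //; exact: lty_fin_num_fun.
have -> : m1 \o ysection S = cst (fine (mu A))%:E.
  apply/funext => y; apply: etrans (m1E _) _.
  rewrite (_ : ysection S y = (fun x => x * y) @^-1` A); last first.
    by apply/seteqP; split=> x; rewrite /ysection /S /= inE.
  by rewrite muR // fineK //; exact: lty_fin_num_fun.
rewrite !integral_cst // !fineK; [|exact: lty_fin_num_fun..].
by rewrite -(m1E setT) -(m2E setT) => I; exact: esym I.
Qed.

(** The level sets of [c] are the pieces: on each of them [T] is right
    translation by the common value of [x^-1 * T x]. Right translations carry
    the traces of [T @^-1` A] on the pieces to disjoint sets that cover [A]. *)
Lemma piecewise_right_translation_preserves (R : realType)
    (G : topologicalGroupType) (nu : {measure set (borel G) -> \bar R})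
    (T : G -> G) (c : G -> nat) :
  invariant_measure (fun g x : G => x * g) nu ->
  (forall n, measurable (c @^-1` [set n] : set (borel G))) ->
  (forall x y, c x = c y -> x^-1 * T x = y^-1 * T y) ->
  bijective T ->
  forall A : set (borel G), measurable A -> nu (T @^-1` A) = nu A.
Proof.
move=> nuR mc cT [T' TK T'K] A mA.
(* w n translates the piece of index n; it is arbitrary when the piece is empty *)
have [w wT] : exists w : nat -> G, forall x, T x = x * w (c x).
  pose P n g := forall x, c x = n -> T x = x * g.
  have ex n : exists g, P n g.
    have [[x0 <-]|nx] := pselect (exists x0, c x0 = n).
      by exists (x0^-1 * T x0) => x /cT <-; rewrite mulVKg.
    by exists 1 => x cx; case: nx; exists x.
  have [w wP] := choice ex.
  by exists w => x; exact: wP.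
pose E n : set (borel G) := (c @^-1` [set n]) `&` (fun x => x * w n) @^-1` A.
pose F n : set (borel G) := (fun x => x * (w n)^-1) @^-1` E n.
have mE n : measurable (E n).
  by apply: measurableI => //; apply: borel_measurable_preimage => //;
    exact: continuous_mulgr.
have mF n : measurable (F n).
  by apply: borel_measurable_preimage => //; exact: continuous_mulgr.
have TE : T @^-1` A = \bigcup_n E n.
  apply/seteqP; split=> [x /= Tx|x [n _ [/= <-]]].
    by exists (c x) => //; split=> //=; rewrite -wT.
  by rewrite -wT.
have TF : A = \bigcup_n F n.
  apply/seteqP; split=> [y Ay|y [n _ [/= cy]]]; last by rewrite mulgVK.
  have Ty : T' y = y * (w (c (T' y)))^-1 by rewrite -{2}(T'K y) wT mulgK.
  by exists (c (T' y)) => //; split=> /=; rewrite -?Ty // -wT T'K.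
have FT n y : F n y -> T (y * (w n)^-1) = y /\ c (y * (w n)^-1) = n.
  by move=> [/= cy _]; rewrite wT cy mulgVK.
have tE : trivIset setT E.
  apply/trivIsetP => n m _ _ /eqP nm; apply/seteqP; split=> // x.
  by case=> -[/= cn _] [/= cm _]; apply: nm; rewrite -cn -cm.
have tF : trivIset setT F.
  apply/trivIsetP => n m _ _ /eqP nm; apply/seteqP; split=> // y [Fn Fm].
  have [[Tn cn] [Tm cm]] := (FT _ _ Fn, FT _ _ Fm).
  by apply: nm; rewrite -cn -cm; congr c; apply: (can_inj TK); rewrite Tn Tm.
rewrite TE [in RHS]TF !measure_semi_bigcup //; [|exact: bigcupT_measurable..].
by apply: eq_eseriesr => n _; rewrite /F nuR.
Qed.

Lemma bundle_pushforward (R : realType) (T T' : ptopologicalType)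
    (nu : {measure set (borel T) -> \bar R}) (f : T -> T') :
  continuous f ->
  exists mu : {measure set (borel T') -> \bar R},
    forall A, mu A = nu (f @^-1` A).
Proof.
move=> /continuous_borel_measurable mf.
by unshelve eexists
  (pushforward nu (f : borel T -> borel T') : {measure set (borel T') -> \bar R}).
Qed.

(** Uniqueness of the Haar measure of a compact group, comparing a right invariant
    measure with a left invariant one. *)
Lemma right_invariant_eq_haar (R : realType) (G : topologicalGroupType)
    (mu nu : {measure set (borel G) -> \bar R}) :
  compact [set: G] -> @second_countable G -> haar_measure nu ->
  mu setT = nu setT -> invariant_measure (fun g x : G => x * g) mu ->
  forall A : set (borel G), measurable A -> mu A = nu A.
Proof.
move=> cG scG hnu muT muR A mA.
have nufin : (nu setT < +oo)%E by have [[+ _ _] _ _] := hnu; apply.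
have nu_gt0 : (0 < nu setT)%E.
  by rewrite lt_neqAle measure_ge0 andbT eq_sym; have [_ /eqP] := hnu.
have := invariant_left_right scG _ nufin muR (haar_measure_invariant hnu) mA.
rewrite muT => /(_ nufin) muE.
have nuT : nu setT \is a fin_num by exact: lty_fin_num_fun.
by apply/eqP; rewrite eq_le; apply/andP; split; rewrite -(lee_pmul2r nuT nu_gt0) muE.
Qed.

(** The image of [nu] under inversion is right invariant, hence equal to [nu]:
    compact groups are unimodular. *)
Lemma haar_measure_right_invariant (R : realType) (G : topologicalGroupType)
    (nu : {measure set (borel G) -> \bar R}) :
  compact [set: G] -> @second_countable G -> haar_measure nu ->
  invariant_measure (fun g x : G => x * g) nu.
Proof.
move=> cG scG hnu.
have [mu muE] := bundle_pushforward nu (@invg_continuous G).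
have muR : invariant_measure (fun g x : G => x * g) mu.
  move=> g A mA; rewrite !muE.
  have mVA := borel_measurable_preimage (@invg_continuous G) mA.
  rewrite -(haar_measure_invariant hnu g^-1 mVA).
  by congr (nu _); apply/seteqP; split=> x /=; rewrite invgM invgK.
have muT : mu setT = nu setT by rewrite muE preimage_setT.
have munu := right_invariant_eq_haar cG scG hnu muT muR.
move=> g A mA; rewrite -!munu ?muR //.
by apply: borel_measurable_preimage => //; exact: continuous_mulgr.
Qed.

(** * Matched pairs of subgroups *)

Section subgroup_values.
Variables (H : topologicalGroupType) (S : subgroup H).

Lemma val_mulg (x y : S) : \val (x * y) = \val x * \val y.
Proof. by []. Qed.

Lemma val_invg (x : S) : \val (x^-1) = (\val x)^-1.
Proof. by []. Qed.

Lemma val_1g : \val (1 : S) = 1.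
Proof. by []. Qed.

Lemma subgroup_memP (x : H) : subgroup_set S x <-> exists s : S, \val s = x.
Proof.
split=> [Sx|[s <-]]; last exact: set_valP.
by exists (exist _ x (mem_set Sx)).
Qed.

Lemma continuous_subgroup_val : continuous (\val : S -> H).
Proof. exact: initial_continuous. Qed.

Lemma continuous_val_comp (T : topologicalType) (f : T -> S) :
  continuous f -> continuous (fun x => \val (f x) : H).
Proof.
by move=> cf x; apply: continuous_comp; [exact: cf|exact: continuous_subgroup_val].
Qed.

End subgroup_values.

Section matched_maps.
Variables (H : topologicalGroupType) (G1 G2 : subgroup H).
Hypothesis G1I2 : (G1 : set H) `&` G2 = [set 1].

Lemma factorization_unique (a a' : G2) (b b' : G1) :
  \val a * \val b = \val a' * \val b' -> a = a' /\ b = b'.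
Proof.
move=> ab.
have ab1 : \val (a'^-1 * a) = \val (b' * b^-1).
  by rewrite !val_mulg !val_invg -(mulKg (\val a') (\val b')) -ab !mulgA mulgK.
have a1 : \val (a'^-1 * a) = 1.
  suff : ((G1 : set H) `&` G2) (\val (a'^-1 * a)) by rewrite G1I2.
  by split; [rewrite ab1|]; exact: set_valP.
have b1 : \val (b' * b^-1) = 1 by rewrite -ab1.
split; last exact/esym/divg1_eq/val_inj.
by rewrite -[a']invgK; apply/esym/mulg1_eq/val_inj.
Qed.

Hypothesis G1M2 : [set x * y | x in (G1 : set H) & y in (G2 : set H)] = setT.

(** The hypothesis factors [h^-1] with the factor from [G1] on the left; inverting
    swaps the order. *)
Lemma factorization_exists (h : H) :
  exists (a : G2) (b : G1), h = \val a * \val b.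
Proof.
have : [set: H] h^-1 by [].
rewrite -G1M2 => -[x /subgroup_memP[r <-] [y /subgroup_memP[g <-] rg]].
by exists g^-1, r^-1; rewrite !val_invg -invgM rg invgK.
Qed.

Variables (alpha : G1 -> G2 -> G2) (beta : G2 -> G1 -> G1).
Hypothesis alphabeta : forall (r : G1) (g : G2),
  \val r * \val g = \val (alpha r g) * \val (beta g r).

Lemma matched_mapsE (r : G1) (g a : G2) (b : G1) :
  \val r * \val g = \val a * \val b -> alpha r g = a /\ beta g r = b.
Proof. by rewrite alphabeta => /factorization_unique. Qed.

Lemma matched_mapsMr (r : G1) (g h : G2) :
  alpha r (g * h) = alpha r g * alpha (beta g r) h /\
  beta (g * h) r = beta h (beta g r).
Proof.
by apply: matched_mapsE; rewrite !val_mulg mulgA alphabeta -mulgA alphabeta mulgA.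
Qed.

Lemma matched_mapsMl (r s : G1) (g : G2) :
  alpha (r * s) g = alpha r (alpha s g) /\
  beta g (r * s) = beta (alpha s g) r * beta g s.
Proof.
by apply: matched_mapsE; rewrite !val_mulg -mulgA alphabeta mulgA alphabeta mulgA.
Qed.

Lemma matched_maps1r (r : G1) : alpha r 1 = 1 /\ beta 1 r = r.
Proof. by apply: matched_mapsE; rewrite !val_1g mulg1 mul1g. Qed.

Lemma matched_maps1l (g : G2) : alpha 1 g = g /\ beta g 1 = 1.
Proof. by apply: matched_mapsE; rewrite !val_1g mulg1 mul1g. Qed.

(** If [alpha] is trivial then [g^-1 r g = beta g r], so that [G2], and hence
    [H = G2 G1], normalizes [G1]. *)
Lemma trivial_alphaP : trivial_action alpha <-> normal_subgroup G1.
Proof.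
split=> [alpha1 x y /subgroup_memP[r <-]|nG1 r g].
  have [g [b ->]] := factorization_exists y.
  have -> : \val r ^ (\val g * \val b) = \val (beta g r ^ b).
    have -> : \val (beta g r ^ b) = \val (beta g r) ^ \val b by [].
    rewrite conjgM; congr (_ ^ _).
    by rewrite conjgE alphabeta alpha1 mulKg.
  exact: set_valP.
have /subgroup_memP[b bE] : subgroup_set G1 (\val r ^ \val g).
  by apply: nG1; exact: set_valP.
by have [] // := @matched_mapsE r g g b _; rewrite bE conjgE mulVKg.
Qed.

(** If [beta] is trivial then [r g r^-1 = alpha r g], so that [G1], and hence
    [H = G2 G1], normalizes [G2]. *)
Lemma trivial_betaP : trivial_action beta <-> normal_subgroup G2.
Proof.
split=> [beta1 x y /subgroup_memP[g <-]|nG2 g r].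
  have [a [b ->]] := factorization_exists y.
  have -> : \val g ^ (\val a * \val b) = \val (alpha b^-1 (g ^ a)).
    have gaE : \val (g ^ a) = \val g ^ \val a by [].
    by rewrite conjgM conjgE -gaE mulgA -val_invg alphabeta beta1 val_invg mulgVK.
  exact: set_valP.
have /subgroup_memP[a aE] : subgroup_set G2 (\val g ^ (\val r)^-1).
  by apply: nG2; exact: set_valP.
by have [] // := @matched_mapsE r g a r _; rewrite aE conjgE invgK !mulgA mulgVK.
Qed.

Hypothesis cG2 : compact [set: G2].
Hypothesis closedG1 : closed (G1 : set H).

Lemma alpha_continuous : continuous (fun p : G1 * G2 => alpha p.1 p.2).
Proof.
apply: closed_graph_continuous => //.
rewrite (_ : [set _ | _] = (fun p : (G1 * G2) * G2 =>
    (\val p.2)^-1 * (\val p.1.1 * \val p.1.2)) @^-1` G1).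
  apply: preimage_closed => // p _; move: p; apply: continuous_mulg.
    by apply/continuous_invg/continuous_val_comp => ?; exact: cvg_snd.
  apply: continuous_mulg; apply: continuous_val_comp => p.
    by apply: continuous_comp => ?; exact: cvg_fst.
  by apply: continuous_comp => ?; [exact: cvg_fst|exact: cvg_snd].
apply/seteqP; split=> -[[r g] a] /= => [<-|/subgroup_memP[b bE]].
  by rewrite alphabeta mulKg; exact: set_valP.
by have [] // := @matched_mapsE r g a b _; rewrite bE mulVKg.
Qed.

Lemma beta_continuous : continuous (fun p : G1 * G2 => beta p.2 p.1).
Proof.
apply: continuous_comp_initial.
rewrite (_ : _ \o _ = fun p : G1 * G2 =>
  (\val (alpha p.1 p.2))^-1 * (\val p.1 * \val p.2)); last first.
  by apply/funext => -[r g] /=; rewrite alphabeta mulKg.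
apply: continuous_mulg.
  exact/continuous_invg/continuous_val_comp/alpha_continuous.
by apply: continuous_mulg; apply: continuous_val_comp => ?;
  [exact: cvg_fst|exact: cvg_snd].
Qed.

(** Conjugating the right translation by [z] with [alpha r] yields a map whose
    translating factor depends on [x] only through [beta x r]. *)
Lemma alpha_right_translation (r : G1) (x z : G2) :
  alpha r^-1 (alpha r x * z) = x * alpha (beta x r)^-1 z.
Proof.
have [aV bV] := matched_mapsMl r^-1 r x.
have [a1 b1] := matched_maps1l x.
rewrite mulVg a1 in aV; rewrite mulVg b1 in bV.
have [-> _] := matched_mapsMr r^-1 (alpha r x) z.
rewrite -aV; congr (x * alpha _ z).
by rewrite -[LHS]invgK; congr (_^-1); exact: mulg1_eq (esym bV).
Qed.

Lemma alphaK (r : G1) : cancel (alpha r) (alpha r^-1).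
Proof.
by move=> g; rewrite -(matched_mapsMl _ _ _).1 mulVg (matched_maps1l g).1.
Qed.

Lemma alphaVK (r : G1) : cancel (alpha r^-1) (alpha r).
Proof. by move=> g; rewrite -{1}[r]invgK alphaK. Qed.

(** It suffices that the image [mu] of [nu] under [alpha r] is right invariant,
    that is, that each [x |-> alpha r^-1 (alpha r x * z)] preserves [nu]. *)
Lemma haar_alpha_invariant (R : realType)
    (nu : {measure set (borel G2) -> \bar R}) :
  @second_countable G2 -> discrete_group G1 -> haar_measure nu ->
  invariant_measure alpha nu.
Proof.
move=> scG2 [oG1 /countable_injP[f f_inj]] hnu r A mA.
have c_alpha : continuous (alpha r).
  move=> g; apply: (@continuous_comp _ _ _ (fun g => (r, g))
    (fun p : G1 * G2 => alpha p.1 p.2)); last exact: alpha_continuous.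
  apply: (cvg_pair (F := nbhs g) (G := nbhs r) (H := nbhs g)).
    exact: cvg_cst.
  exact: cvg_id.
have c_beta : continuous (fun g => beta g r).
  move=> g; apply: (@continuous_comp _ _ _ (fun g => (r, g))
    (fun p : G1 * G2 => beta p.2 p.1)); last exact: beta_continuous.
  apply: (cvg_pair (F := nbhs g) (G := nbhs r) (H := nbhs g)).
    exact: cvg_cst.
  exact: cvg_id.
have nuR := haar_measure_right_invariant cG2 scG2 hnu.
have [mu muE] := bundle_pushforward nu c_alpha.
have muT : mu setT = nu setT by rewrite muE preimage_setT.
have muR : invariant_measure (fun g x : G2 => x * g) mu.
  move=> z B mB; rewrite !muE.
  pose T x := alpha r^-1 (alpha r x * z).
  have -> : alpha r @^-1` ((fun x => x * z) @^-1` B) = T @^-1` (alpha r @^-1` B).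
    by apply/seteqP; split=> x; rewrite /T /= alphaVK.
  (* f numbers the countable group G1, so f (beta x r) indexes the pieces *)
  apply: (@piecewise_right_translation_preserves _ _ _ _ (fun x => f (beta x r))).
  - exact: nuR.
  - move=> n; apply: borel_measurable_open.
    by apply: (open_comp (f := fun g => beta g r) (D := f @^-1` [set n])).
  - move=> x y /f_inj; rewrite !inE => /(_ Logic.I Logic.I) xy.
    by rewrite /T !alpha_right_translation !mulKg xy.
  - exists (fun y => alpha r^-1 (alpha r y * z^-1)) => y.
      by rewrite /T alphaVK mulgK alphaK.
    by rewrite /T alphaVK mulgVK alphaK.
  - exact: borel_measurable_preimage.
by rewrite -muE; exact: right_invariant_eq_haar.
Qed.

End matched_maps.

Lemma matched_pair_mul (R : realType) (H : topologicalGroupType)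
    (G1 G2 : subgroup H) :
  matched_pair R G1 G2 -> compact [set: G2] ->
  [set x * y | x in (G1 : set H) & y in (G2 : set H)] = [set: H].
Proof.
move=> [[hH _] [clG1 _] _ [mu [hmu [N [mN N0 GN]]]]] cG2.
have cG2H : compact (G2 : set H).
  have -> : (G2 : set H) = (\val : G2 -> H) @` [set: G2].
    apply/seteqP; split=> [x /subgroup_memP[g <-]|_ [g _ <-]]; first by exists g.
    exact: set_valP.
  apply: continuous_compact => //; apply: continuous_subspaceT.
  exact: continuous_subgroup_val.
have := closed_mul_compact clG1 cG2H; rewrite -openC => oC.
apply/seteqP; split=> // h _; apply: contrapT => nGh.
apply: (haar_measure_open_neq0 hH hmu oC nGh).
apply/eqP; rewrite eq_le measure_ge0 andbT -N0.
by apply: le_measure; rewrite ?inE //; exact: borel_measurable_open.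
Qed.

Theorem proposition3p2 (R : realType) (H : topologicalGroupType)
    (G1 G2 : subgroup H) :
  matched_pair R G1 G2 -> compact_group G2 ->
  [/\ [set x * y | x in (G1 : set H) & y in (G2 : set H)] = [set: H],
      forall (r : G1) (g : G2),
        exists! p : G2 * G1, \val r * \val g = \val p.1 * \val p.2
    & forall (alpha : G1 -> G2 -> G2) (beta : G2 -> G1 -> G1),
        (forall (r : G1) (g : G2),
          \val r * \val g = \val (alpha r g) * \val (beta g r)) ->
        [/\ forall (g h : G2) (r s : G1),
              [/\ alpha r (g * h) = alpha r g * alpha (beta g r) h,
                  beta g (r * s) = beta (alpha s g) r * beta g s,
                  alpha r 1 = 1
                & beta g 1 = 1],
            continuous_left_action alpha /\
            (discrete_group G1 ->
              forall nu : {measure set (borel G2) -> \bar R},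
                haar_measure nu -> invariant_measure alpha nu),
            continuous_right_action beta
          & (trivial_action alpha <-> normal_subgroup G1) /\
            (trivial_action beta <-> normal_subgroup G2)]].
Proof.
move=> matched [_ cG2 scG2].
have G1M2 := matched_pair_mul matched cG2.
have [_ [clG1 _] G1I2 _] := matched.
split=> // [r g|alpha beta ab].
  have [a [b rg]] := factorization_exists G1M2 (\val r * \val g).
  exists (a, b); split=> //= -[a' b'] /=; rewrite rg => rg'.
  by have [-> ->] := factorization_unique G1I2 rg'.
have Mr r g h := matched_mapsMr G1I2 ab r g h.
have Ml r s g := matched_mapsMl G1I2 ab r s g.
have m1r r := matched_maps1r G1I2 ab r.
have m1l g := matched_maps1l G1I2 ab g.
split.
- move=> g h r s.
  by rewrite (Mr r g h).1 (Ml r s g).2 (m1r r).1 (m1l g).2.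
- split; first split.
  + by move=> g; case: (m1l g).
  + by move=> r s g; case: (Ml r s g).
  + exact: alpha_continuous ab _ _.
  + by move=> dG1 nu hnu; exact: (haar_alpha_invariant G1I2 ab).
- split.
  + by move=> r; case: (m1r r).
  + by move=> g h r; case: (Mr r g h).
  + exact: beta_continuous ab _ _.
- by split; [exact: trivial_alphaP|exact: trivial_betaP].
Qed.
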